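(* Let $(V,\psi)$ be a symplectic vector space and let $\lambda_1,\lambda_2,\lambda_3$ be any three Lagrangian subspaces of $V$. Then $$\mu(\lambda_1,\lambda_2,\lambda_3)\equiv \dim(\lambda_1)+\sum_{1\le i<j\le 3}\dim(\lambda_i\cap\lambda_j)\pmod 2$$ and $$\mu(\lambda_1,\lambda_2,\lambda_3)\equiv \dim(\lambda_1)+\sum_{1\le i<j\le 3}\dim(\lambda_i+\lambda_j)\pmod 2 .$$
   Context: A symplectic vector space $(V,\psi)$ here means a finite-dimensional real vector space $V$ with a skew-symmetric bilinear form $\psi$ which is NOT required to be nondegenerate. For a subspace $A\subset V$, $\operatorname{Ann}(A)=\{v\in V:\psi(v,a)=0\text{ for all }a\in A\}$. A subspace $A$ is Lagrangian if $A=\operatorname{Ann}(A)$. Maslov index: for Lagrangian subspaces $\lambda_1,\lambda_2,\lambda_3$ of $V$, define a form on $(\lambda_1+\lambda_2)\cap\lambda_3$ by $\langle a,b\rangle=\psi(a_2,b)$, where $a=a_1+a_2$ with $a_1\in\lambda_1$, $a_2\in\lambda_2$. This is a well-defined symmetric bilinear form (possibly degenerate), and $\mu(\lambda_1,\lambda_2,\lambda_3)\in\mathbb{Z}$ is its signature (number of positive minus number of negative diagonal entries in a diagonalization). *)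

(* Defs.v *)
From HB Require Import structures.
From mathcomp Require Import all_boot all_order all_algebra.
From mathcomp Require Import boolp classical_sets reals.

Set Implicit Arguments.
Unset Strict Implicit.
Unset Printing Implicit Defensive.

Import Order.TTheory GRing.Theory Num.Theory.
Local Open Scope ring_scope.

Section Signature.
Variables (R : realType) (V : vectType R).
Implicit Types (f : V -> V -> R) (W : {vspace V}) (b : seq V).

Definition orthogonal_basis f W b : Prop :=
  basis_of W b /\ {in b &, forall x y, x != y -> f x y = 0}.

(* The diagonal entries of the Gram matrix of f in b are the f x x, x in b. *)
Definition diag_signature f b : int :=
  (count (fun x => 0 < f x x) b)%:Z - (count (fun x => f x x < 0) b)%:Z.

(* A basis diagonalizing f is selected by choice; for f bilinear and symmetric *)
(* on W one exists (orthogonal_basis_exists) and the value does not depend on *)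
(* the selected one (signatureE).                                             *)
Definition signature f W : int :=
  diag_signature f (xget [::] [set b | orthogonal_basis f W b]).

End Signature.

Section SignatureTheory.
Variables (R : realType) (V : vectType R) (f : {biscalar V}).
Implicit Types (W : {vspace V}) (b : seq V).

Lemma orthogonal_basis_exists W :
  {in W &, forall x y, f x y = f y x} -> exists b, orthogonal_basis f W b.
Proof.
move Dn: (\dim W) => n; elim: n W Dn => [|n IHn] W dimW symf.
  exists [::]; split => //; move/eqP: dimW; rewrite dimv_eq0 => /eqP->.
  exact: nil_basis.
have [[u [uW fu0]]|allz] := pselect (exists u, u \in W /\ f u u != 0); last first.
  have z u : u \in W -> f u u = 0.
    by move=> uW; apply/eqP/negPn/negP => fu; apply: allz; exists u.
  exists (vbasis W); split=> [|x y /vbasis_mem xW /vbasis_mem yW _]; first exact: vbasisP.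
  have := z _ (rpredD xW yW).
  rewrite linearDl !linearDr !z // add0r addr0 (symf y x) // -mulr2n.
  by move/eqP; rewrite mulrn_eq0 /= => /eqP.
pose g : 'Hom(V, R^o) := linfun (f u : V -> R^o).
have gE v : g v = f u v by rewrite lfunE.
have un0 : u != 0 by apply: contraNneq fu0 => ->; rewrite linear0l.
have lkP v : (v \in lker g) = (f u v == 0) by rewrite memv_ker gE.
have uW' : (<[u]> :&: (W :&: lker g) = 0)%VS.
  apply/eqP; rewrite -subv0; apply/subvP => v; rewrite memv_cap memv_cap.
  case/and3P => /vlineP[k ->] _; rewrite lkP linearZr_LR /= mulf_eq0 (negPf fu0) orbF.
  by move/eqP->; rewrite scale0r mem0v.
have WE : (<[u]> + (W :&: lker g) = W)%VS.
  apply/eqP; rewrite eqEsubv subv_add -memvE uW capvSl /=.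
  apply/subvP => v vW.
  pose c := f u v / f u u.
  rewrite -[v](subrK (c *: u)) addrC memv_add ?memvZ ?memv_line // memv_cap.
  rewrite rpredB ?memvZ //= lkP linearBr linearZr_LR /= /c -mulrA mulVf //.
  by rewrite mulr1 subrr.
have dW' : \dim (W :&: lker g) = n.
  by move: (dimv_disjoint_sum uW'); rewrite WE dimW dim_vline un0 => -[].
have [|b [bW' ob]] := IHn _ dW'.
  by move=> x y /memv_capP[xW _] /memv_capP[yW _]; exact: symf.
have fub y : y \in b -> (f u y = 0) * (f y u = 0).
  move=> /(basis_mem bW')/memv_capP[yW]; rewrite lkP => /eqP fuy.
  by split; rewrite // symf.
exists (u :: b); split; last first.
  move=> x y; rewrite !inE => /predU1P[->|xb] /predU1P[->|yb]; rewrite ?eqxx //.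
  - by rewrite (fub y yb).1.
  - by rewrite (fub x xb).2.
  - exact: ob.
rewrite -WE -cat1s; apply: cat_basis; rewrite ?seq1_basis //.
exact/directv_addP.
Qed.

Let orthE b v : free b -> {in b &, forall x y, x != y -> f x y = 0} ->
  v \in <<b>>%VS -> exists2 k : V -> R,
    v = \sum_(x <- b) k x *: x & f v v = \sum_(x <- b) k x ^+ 2 * f x x.
Proof.
move=> fb ob /(free_span fb)[k -> _]; exists k => //.
rewrite linear_sumlz; apply: eq_big_seq => x xb.
rewrite linear_sumr (bigD1_seq x) ?free_uniq //= big1_seq => [|y /andP[yx yb]].
  by rewrite addr0 linearZl_LR linearZr_LR /= mulrA.
by rewrite linearZl_LR linearZr_LR /= ob ?mulr0 // eq_sym.
Qed.

Let inertia_le (s : R) W b b' :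
  orthogonal_basis f W b -> orthogonal_basis f W b' ->
  (count (fun x => 0 < s * f x x)%R b <= count (fun x => 0 < s * f x x)%R b')%N.
Proof.
move=> [bW ob] [b'W ob']; set p := fun x : V => _.
have cap0 : (<<filter p b>> :&: <<filter (predC p) b'>> = 0)%VS.
  apply/eqP; rewrite -subv0; apply/subvP => v /memv_capP[vP vN].
  have [||k vk fk] := orthE _ _ vP.
  - exact/filter_free/basis_free/bW.
  - by move=> x y; rewrite !mem_filter => /andP[_ xb] /andP[_ yb]; exact: ob.
  have [||l _ fl] := orthE _ _ vN.
  - exact/filter_free/basis_free/b'W.
  - by move=> x y; rewrite !mem_filter => /andP[_ xb] /andP[_ yb]; exact: ob'.
  have le0 : s * f v v <= 0.
    rewrite fl mulr_sumr big_seq sumr_le0 // => x.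
    rewrite mem_filter /= /p -leNgt => /andP[px _].
    by rewrite mulrCA mulr_ge0_le0 ?sqr_ge0.
  have ge0 x : x \in filter p b -> 0 <= k x ^+ 2 * (s * f x x).
    by rewrite mem_filter => /andP[px _]; rewrite mulr_ge0 ?sqr_ge0 // ltW.
  have sum0 : \sum_(x <- filter p b | x \in filter p b) k x ^+ 2 * (s * f x x) == 0.
    rewrite eq_le sumr_ge0 ?andbT // -big_seq; apply: le_trans le0.
    by rewrite fk mulr_sumr; under eq_bigr do rewrite mulrCA.
  move: sum0; rewrite psumr_eq0 // => /allP sum0.
  rewrite vk big_seq big1 ?mem0v // => x xP; have /implyP/(_ xP) := sum0 x xP.
  move: (xP); rewrite mem_filter => /andP[px _].
  by rewrite mulf_eq0 (gt_eqF px) orbF sqrf_eq0 => /eqP->; rewrite scale0r.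
have sub : (<<filter p b>> + <<filter (predC p) b'>> <= W)%VS.
  rewrite subv_add; apply/andP; split; apply/span_subvP => x; rewrite mem_filter.
    by case/andP => _; exact: basis_mem bW.
  by case/andP => _; exact: basis_mem b'W.
move: (dimvS sub); rewrite dimv_disjoint_sum //.
rewrite (eqP (filter_free p (basis_free bW))).
rewrite (eqP (filter_free (predC p) (basis_free b'W))) !size_filter.
rewrite (size_basis (X := in_tuple b') b'W) -(count_predC p b').
by rewrite leq_add2r.
Qed.

(* Sylvester's law of inertia. *)
Lemma signatureE W b : orthogonal_basis f W b -> signature f W = diag_signature f b.
Proof.
move=> bW; have b'W := xgetI (P := orthogonal_basis f W) [::] bW.
rewrite /signature; set b' := xget _ _ in b'W *.
have inertia s : count (fun x => 0 < s * f x x) b = count (fun x => 0 < s * f x x) b'.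
  by apply/eqP; rewrite eqn_leq !(inertia_le _ (W := W)).
have pos c : count (fun x => 0 < f x x) c = count (fun x => 0 < 1 * f x x) c.
  by apply: eq_count => x; rewrite mul1r.
have neg c : count (fun x => f x x < 0) c = count (fun x => 0 < -1 * f x x) c.
  by apply: eq_count => x; rewrite mulN1r oppr_gt0.
by rewrite /diag_signature !pos !neg !inertia.
Qed.

End SignatureTheory.

Section Maslov.
Variables (R : realType) (V : vectType R) (psi : {skew_symmetric V}).
Implicit Types (A : {vspace V}) (a b : V).

(* orthov psi A is the space of the v such that psi v a = 0 for all a in A. *)
Definition lagrangian A : Prop := A = orthov psi A.

(* addv_pi1 A1 A2 a + addv_pi2 A1 A2 a is a decomposition of a in A1 + A2;    *)
(* maslov_formE shows that any other one gives the same value.                *)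
Definition maslov_form A1 A2 a b : R := psi (addv_pi2 A1 A2 a) b.

Definition maslov A1 A2 A3 : int :=
  signature (maslov_form A1 A2) ((A1 + A2) :&: A3)%VS.

Lemma maslov_form_is_bilinear A1 A2 : bilinear_for
  (GRing.Scale.Law.clone _ _ *%R _) (GRing.Scale.Law.clone _ _ *%R _)
  (maslov_form A1 A2).
Proof.
split=> [b|a] c x y; rewrite /maslov_form.
  by rewrite linearP linearDl linearZl_LR.
by rewrite linearDr linearZr_LR.
Qed.

HB.instance Definition _ A1 A2 := bilinear_isBilinear.Build R V V R _ _
  (maslov_form A1 A2) (maslov_form_is_bilinear A1 A2).

Let lagr0 A x y : lagrangian A -> x \in A -> y \in A -> psi x y = 0.
Proof. by move=> lA; rewrite {1}lA => /mem_orthovP h /h. Qed.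

Let psiDl x y z : psi (x + y) z = psi x z + psi y z.
Proof. exact: linearDl. Qed.

Let psiDr x y z : psi x (y + z) = psi x y + psi x z.
Proof. exact: linearDr. Qed.

Let skewC x y : psi x y = - psi y x.
Proof. by rewrite hermC /= expr1 mulN1r. Qed.

Lemma maslov_formE A1 A2 a1 a2 b : lagrangian A1 -> lagrangian A2 ->
  a1 \in A1 -> a2 \in A2 -> b \in (A1 + A2)%VS ->
  maslov_form A1 A2 (a1 + a2) b = psi a2 b.
Proof.
move=> L1 L2 a1A a2A /memv_addP[b1 b1A [b2 b2A ->]].
have aA : a1 + a2 \in (A1 + A2)%VS by rewrite memv_add.
rewrite /maslov_form; set c2 := addv_pi2 _ _ _.
have c2A : c2 \in A2 := memv_pi2 _ _ _.
have d1 : c2 - a2 \in A1.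
  have -> : c2 - a2 = a1 - addv_pi1 A1 A2 (a1 + a2).
    apply/eqP; rewrite subr_eq addrAC -[X in X - _](addv_pi1_pi2 aA).
    by rewrite addrAC subrr add0r.
  by rewrite rpredB ?memv_pi1.
rewrite -[c2](subrK a2) psiDl [X in X + _]psiDr (lagr0 L1 d1 b1A).
by rewrite (lagr0 L2 _ b2A) ?rpredB // addr0 add0r.
Qed.

Lemma maslov_form_sym A1 A2 A3 :
  lagrangian A1 -> lagrangian A2 -> lagrangian A3 ->
  {in ((A1 + A2) :&: A3)%VS &,
     forall a b, maslov_form A1 A2 a b = maslov_form A1 A2 b a}.
Proof.
move=> L1 L2 L3 a b /memv_capP[aA a3] /memv_capP[bA b3].
move: (aA) (bA) => /memv_addP[a1 a1A [a2 a2A Da]] /memv_addP[b1 b1A [b2 b2A Db]].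
rewrite {1}Da maslov_formE // {2}Db maslov_formE // Da Db !psiDr.
rewrite (lagr0 L2 a2A b2A) (lagr0 L2 b2A a2A) !addr0.
have := lagr0 L3 a3 b3; rewrite Da Db psiDl !psiDr.
rewrite (lagr0 L1 a1A b1A) (lagr0 L2 a2A b2A) add0r addr0 (skewC a1).
by move/eqP; rewrite addrC subr_eq0 => /eqP.
Qed.

End Maslov.

(* Main.v *)
(** The signature of a symmetric form has the parity of its rank, that is, of
    the dimension of the space plus that of the radical. On (l1 + l2) ∩ l3 the
    radical is (l1 ∩ l3) + (l2 ∩ l3): if a = a1 + a2 lies in it then
    a2 ∈ Ann ((l1 + l2) ∩ l3) = (l1 ∩ l2) + l3, and the component of a2 in
    l1 ∩ l2 can be moved to a1. All Lagrangians have dimension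
    n = (dim V + dim (Ann V)) / 2, and l1 + l2 + l3 has annihilator
    l1 ∩ l2 ∩ l3, so dim (l1 + l2 + l3) + dim (l1 ∩ l2 ∩ l3) = 2n; the rest is
    the dimension formula for sums. *)
From HB Require Import structures.
Require Import Defs.
From mathcomp Require Import all_boot all_order all_algebra.
From mathcomp Require Import reals.
From mathcomp Require Import zify.

Local Open Scope ring_scope.
Import GRing.Theory Num.Theory.

Set Implicit Arguments.
Unset Strict Implicit.
Unset Printing Implicit Defensive.

Section OrthogonalDimension.
Variables (F : fieldType) (V : vectType F) (psi : {skew_symmetric V}).
Implicit Types U W A : {vspace V}.

Lemma skew_symmetricC x y : psi x y = - psi y x.
Proof. by rewrite hermC /= expr1 mulN1r. Qed.

(** Orthogonality to [A] imposes at most [\dim A] linear conditions on [U]: this is rank-nullity on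
    [U] for the pairing with a basis of [A]. *)
Lemma leq_dim_capv_orthov U A : (\dim U <= \dim (U :&: orthov psi A) + \dim A)%N.
Proof.
pose g v : 'rV[F]_(\dim A) := \row_i psi v (vbasis A)`_i.
have linear_g : linear g.
  by move=> c u v; apply/rowP=> i; rewrite !mxE linearDl linearZl_LR.
pose G := GRing.isLinear.Build _ _ _ _ g linear_g.
pose gL : {linear V -> 'rV[F]_(\dim A)} := HB.pack g G.
have gE v : linfun gL v = g v by rewrite lfunE.
rewrite -(limg_ker_dim (linfun gL) U) leq_add //.
  apply/dimvS/capvS => //; apply/subvP => v; rewrite memv_ker gE.
  move=> /eqP gv0; apply/mem_orthovP => a /coord_vbasis->.
  rewrite linear_sumr big1 // => i _; rewrite linearZr_LR /=.
  by have /rowP/(_ i) := gv0; rewrite !mxE => ->; rewrite mulr0.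
by apply: leq_trans (dimvS (subvf _)) _; rewrite dimvf /dim /= mul1n.
Qed.

(* Row rank and column rank of the pairing U x W -> F agree. *)
Lemma dim_capv_orthov U W :
  (\dim U + \dim (W :&: orthov psi U) = \dim W + \dim (U :&: orthov psi W))%N.
Proof.
have le A B : (\dim A + \dim (B :&: orthov psi A) <=
               \dim B + \dim (A :&: orthov psi B))%N.
  (* The part of [B] orthogonal to [A] imposes no condition on [A], so only its complement [C] in
     [B] counts in the bound above. *)
  pose C := (B :\: (B :&: orthov psi A))%VS.
  have BE : (C + B :&: orthov psi A = B)%VS.
    by have := addv_diff_cap B (B :&: orthov psi A); rewrite capvA capvv.
  have dC : (\dim C + \dim (B :&: orthov psi A) = \dim B)%N.
    by have := dimv_cap_compl B (B :&: orthov psi A); rewrite capvA capvv addnC.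
  have sub : (A :&: orthov psi C <= A :&: orthov psi B)%VS.
    apply/subvP => v /memv_capP[vA /mem_orthovP vC]; rewrite memv_cap vA.
    apply/mem_orthovP => w; rewrite -BE => /memv_addP[c cC [d]].
    case/memv_capP => _ /mem_orthovP dA ->.
    by rewrite linearDr /= vC // skew_symmetricC dA // oppr0 addr0.
  by move: (leq_dim_capv_orthov A C) (dimvS sub); lia.
by apply/eqP; rewrite eqn_leq !le.
Qed.

End OrthogonalDimension.

Section SignatureParity.
Variables (R : realType) (V : vectType R) (f : {biscalar V}).
Implicit Types (W K : {vspace V}) (b : seq V).

(** The isotropic vectors of an orthogonal basis span the radical: pairing a radical vector with a
    basis vector [x] gives its coordinate times [f x x]. [K] is given by its membership, so that a
    radical computed in another way can be used. *)
Lemma count_isotropic_basis W K b : orthogonal_basis f W b ->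
  (forall v, reflect (v \in W /\ {in W, forall w, f v w = 0}) (v \in K)) ->
  count (fun x => f x x == 0) b = \dim K.
Proof.
move=> [bW ob] KP; have fb := basis_free bW.
have -> : K = <<[seq x <- b | (f x x == 0)%R]>>%VS.
  apply/eqP; rewrite eqEsubv; apply/andP; split; last first.
    apply/span_subvP => x; rewrite mem_filter => /andP[/eqP fx0 xb].
    apply/KP; split=> [|w]; first exact: (basis_mem bW).
    rewrite -(span_basis bW) => /(free_span fb)[k -> _].
    rewrite linear_sumr big_seq big1 // => y yb; rewrite linearZr_LR /=.
    by have [<-|xy] := eqVneq x y; rewrite ?fx0 ?ob // mulr0.
  apply/subvP => v /KP[]; rewrite -{1}(span_basis bW) => /(free_span fb)[k -> _] h.
  rewrite big_seq rpred_sum // => x xb.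
  have [fx0|fxN0] := eqVneq (f x x) 0.
    by rewrite rpredZ // memv_span // mem_filter fx0 eqxx.
  have := h x (basis_mem bW xb).
  rewrite linear_sumlz (bigD1_seq x) ?free_uniq //= big1_seq => [|y /andP[yx yb]].
    rewrite linearZl_LR addr0 => /eqP; rewrite mulf_eq0 (negPf fxN0) orbF.
    by move/eqP->; rewrite scale0r mem0v.
  by rewrite linearZl_LR /= ob // mulr0.
by rewrite (eqP (filter_free _ fb)) size_filter.
Qed.

(** With p positive, q negative and z zero diagonal entries, p - q and (p + q + z) + z have the same
    parity. *)
Lemma signature_parity W K : {in W &, forall x y, f x y = f y x} ->
  (forall v, reflect (v \in W /\ {in W, forall w, f v w = 0}) (v \in K)) ->
  (signature f W = (\dim W + \dim K)%N%:Z %[mod 2])%Z.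
Proof.
move=> symf KP; have [b bW] := orthogonal_basis_exists symf.
rewrite (signatureE bW) /diag_signature -(count_isotropic_basis bW KP).
have -> : \dim W = size b := size_basis (X := in_tuple b) bW.1.
have -> : size b = (count (fun x => 0 < f x x)%R b + count (fun x => f x x < 0)%R b
                    + count (fun x => f x x == 0%R) b)%N.
  by elim: b {bW} => //= x b ->; case: ltrgt0P => _ /=; lia.
do 3!move: (count _ b) => ?; lia.
Qed.

End SignatureParity.

Section LagrangianDimension.
Variables (R : realType) (V : vectType R) (psi : {skew_symmetric V}).
Implicit Types A B C : {vspace V}.

Let rad := orthov psi fullv.

Lemma orthov_full_sub_lagrangian A : lagrangian psi A -> (rad <= A)%VS.
Proof.
move=> ->; apply/subvP => v /mem_orthovP v0; apply/mem_orthovP => a _.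
exact/v0/memvf.
Qed.

(** The form may be degenerate, so its radical [rad] enters the usual formula; here [A] meets the
    annihilator of the whole space in [rad]. *)
Lemma dim_orthov A : (rad <= A)%VS ->
  (\dim A + \dim (orthov psi A) = \dim {:V} + \dim rad)%N.
Proof.
by move=> /capv_idPr radA; have := dim_capv_orthov psi A fullv; rewrite capfv radA.
Qed.

Lemma orthov_addv A B : orthov psi (A + B) = (orthov psi A :&: orthov psi B)%VS.
Proof.
apply/vspaceP => v; rewrite memv_cap.
apply/mem_orthovP/andP => [vAB|[/mem_orthovP vA /mem_orthovP vB] w].
  split; apply/mem_orthovP => w wA; apply: vAB; first exact: subvP (addvSl _ _) _ wA.
  exact: subvP (addvSr _ _) _ wA.
by case/memv_addP => a aA [c cB ->]; rewrite linearDr /= vA ?vB ?addr0.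
Qed.

Lemma dim_lagrangian_double A : lagrangian psi A ->
  (\dim A + \dim A = \dim {:V} + \dim rad)%N.
Proof.
by move=> LA; rewrite {2}LA; apply/dim_orthov/orthov_full_sub_lagrangian.
Qed.

Lemma dim_lagrangian A B : lagrangian psi A -> lagrangian psi B -> \dim A = \dim B.
Proof. by move=> /dim_lagrangian_double dA /dim_lagrangian_double dB; lia. Qed.

Lemma dim_addv3_lagrangian A B C :
  lagrangian psi A -> lagrangian psi B -> lagrangian psi C ->
  (\dim (A + B + C) + \dim (A :&: B :&: C) = \dim A + \dim A)%N.
Proof.
move=> LA LB LC; rewrite (dim_lagrangian_double LA) {2}LA {2}LB {2}LC -!orthov_addv.
apply: dim_orthov; apply: subv_trans (orthov_full_sub_lagrangian LC) (addvSr _ _).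
Qed.

Lemma orthov_capv_lagrangian A B C :
  lagrangian psi A -> lagrangian psi B -> lagrangian psi C ->
  orthov psi ((A + B) :&: C) = (A :&: B + C)%VS.
Proof.
move=> LA LB LC.
have orth0 D x y : lagrangian psi D -> x \in D -> y \in D -> psi x y = 0.
  by move=> LD; rewrite {1}LD => /mem_orthovP h /h.
(* One inclusion is direct; equality then follows because, with n the common dimension, both sides
   have dimension 2n - dim ((A + B) ∩ C). *)
apply/esym/eqP; rewrite eqEdim; apply/andP; split.
  apply/subvP => v /memv_addP[x /memv_capP[xA xB] [y yC ->]].
  apply/mem_orthovP => w /memv_capP[/memv_addP[a aA [b bB ->]] abC].
  rewrite linearDl /= (orth0 _ _ _ LC yC abC) addr0 linearDr /=.
  by rewrite (orth0 A) // (orth0 B) // addr0.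
have radW : (rad <= (A + B) :&: C)%VS.
  rewrite subv_cap (orthov_full_sub_lagrangian LC) andbT.
  exact: subv_trans (orthov_full_sub_lagrangian LA) (addvSl _ _).
have := (dim_orthov radW, dim_lagrangian_double LA, dim_lagrangian LA LC,
  dim_lagrangian LA LB, dim_addv3_lagrangian LA LB LC,
  dimv_sum_cap A B, dimv_sum_cap (A + B) C, dimv_sum_cap (A :&: B) C).
by do !case; lia.
Qed.

End LagrangianDimension.

Section MaslovParity.
Variables (R : realType) (V : vectType R) (psi : {skew_symmetric V}).
Variables l1 l2 l3 : {vspace V}.
Hypotheses (h1 : lagrangian psi l1) (h2 : lagrangian psi l2)
  (h3 : lagrangian psi l3).

Lemma maslov_radicalP v :
  reflect (v \in ((l1 + l2) :&: l3)%VS /\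
           {in ((l1 + l2) :&: l3)%VS, forall w, maslov_form psi l1 l2 v w = 0})
          (v \in (l1 :&: l3 + l2 :&: l3)%VS).
Proof.
apply: (iffP idP) => [/memv_addP[x /memv_capP[x1 x3] [y /memv_capP[y2 y3] ->]]|].
  split=> [|w /memv_capP[w12 w3]].
    by rewrite memv_cap memv_add // rpredD.
  by rewrite maslov_formE //; move: y3; rewrite h3 => /mem_orthovP->.
case=> /memv_capP[/memv_addP[a1 a1l [a2 a2l ->]] a3] a0.
have : a2 \in orthov psi ((l1 + l2) :&: l3).
  apply/mem_orthovP => w wW; rewrite -(a0 w wW) maslov_formE //.
  by case/memv_capP: wW.
rewrite orthov_capv_lagrangian // => /memv_addP[c /memv_capP[c1 c2] [d d3 a2E]].
(* Regroup the vector as (a1 + c) + d: a1 + c is in [l3] as the whole minus d, and d is in [l2] as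
   a2 - c. *)
rewrite a2E addrA in a3 *; apply: memv_add; rewrite memv_cap; apply/andP; split.
- exact: rpredD.
- by rewrite -(addrK d (a1 + c)) rpredB.
- by rewrite -(addKr c d) -a2E rpredD ?rpredN.
- by [].
Qed.

Lemma maslov_parity :
  (maslov psi l1 l2 l3 =
     (\dim ((l1 + l2) :&: l3) + \dim (l1 :&: l3 + l2 :&: l3))%N%:Z %[mod 2])%Z.
Proof.
exact: signature_parity (maslov_form_sym h1 h2 h3) maslov_radicalP.
Qed.

End MaslovParity.

Theorem theorem1p1 (R : realType) (V : vectType R) (psi : {skew_symmetric V})
    (l1 l2 l3 : {vspace V})
    (h1 : lagrangian psi l1) (h2 : lagrangian psi l2) (h3 : lagrangian psi l3) :
  (maslov psi l1 l2 l3 =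
     (\dim l1 + (\dim (l1 :&: l2) + \dim (l1 :&: l3) + \dim (l2 :&: l3)))%N%:Z
     %[mod 2])%Z /\
  (maslov psi l1 l2 l3 =
     (\dim l1 + (\dim (l1 + l2) + \dim (l1 + l3) + \dim (l2 + l3)))%N%:Z
     %[mod 2])%Z.
Proof.
have cap3 : (l1 :&: l3 :&: (l2 :&: l3) = l1 :&: l2 :&: l3)%VS.
  by rewrite capvA -(capvA l1 l3) (capvC l3) !capvA -capvA capvv.
(* Write n for the common dimension and d_ij, d_123 for those of the intersections. The two terms of
   [maslov_parity] are n - d_12 + d_123 and d_13 + d_23 - d_123, so d_123 cancels. The second
   congruence follows from the first since dim (l_i + l_j) = 2n - d_ij. *)
have := (dimv_sum_cap l1 l2, dimv_sum_cap l1 l3, dimv_sum_cap l2 l3,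
  dimv_sum_cap (l1 + l2) l3, dimv_sum_cap (l1 :&: l3) (l2 :&: l3),
  dim_addv3_lagrangian h1 h2 h3, dim_lagrangian h1 h2, dim_lagrangian h1 h3).
rewrite cap3 => dims; rewrite maslov_parity //.
by move: dims; do !case; lia.
Qed.
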